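(* Let $G=(V,E)$ be a finite directed graph (possibly cyclic) and consider a finite functional causal model on $G$ with average number of solutions $\overline N$. Let $G_{\mathrm t}\in\mathcal G_{\mathrm{tele}}(G)$ be a teleportation graph with split-vertex set $S$ and consider a classical teleportation model on $G_{\mathrm t}$ constructed from the model on $G$. Then its post-selection success probability satisfies $$P_{\mathrm{succ}}=\Big(\prod_{v\in S}p_{\mathrm{tele}}^{(v)}\Big)\,\overline N,$$ where $p_{\mathrm{tele}}^{(v)}$ is the success probability of the classical post-selected teleportation protocol implemented for the split vertex $v\in S$.
   Context: Graphs. A directed graph $G=(V,E)$ has a finite vertex set $V$ and edges $E\subseteq V\times V$, $(v,w)$ being an edge from $v$ to $w$. $\mathrm{Pa}(v)=\{w:(w,v)\in E\}$, $\mathrm{Ch}(v)=\{w:(v,w)\in E\}$, $\mathrm{out}(v)=\{(v,w)\in E\}$. Finite functional causal model (fCM) on $G$. To each $v\in V$ assign: a random variable $X_v$ with values $x_v$ in a non-empty finite set $\mathcal X_v$; an error variable $U_v$ with values $u_v$ in a finite set $\mathcal U_v$ with probability distribution $p^v$ on $\mathcal U_v$; a function $f^v:\prod_{w\in \mathrm{Pa}(v)}\mathcal X_w\times\mathcal U_v\to\mathcal X_v$. If $G$ is acyclic, its distribution is $P_{\mathrm{acyc}}(x)_G=\sum_u\prod_{v\in V}p^v(u_v)\,\delta_{x_v,f^v(x_{\mathrm{Pa}(v)},u_v)}$ for $x=\{x_v\}_{v\in V}$, the sum being over all $u=\{u_v\in\mathcal U_v\}_{v\in V}$. Number of solutions.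 For $u=\{u_v\in\mathcal U_v\}_{v\in V}$, $N(u)=\sum_{x}\prod_{v\in V}\delta_{f^v(x_{\mathrm{Pa}(v)},u_v),x_v}$ (sum over all $x=\{x_v\in\mathcal X_v\}_{v\in V}$). The average number of solutions is $\overline N=\sum_u N(u)\prod_{v\in V}p^v(u_v)$. Classical post-selected teleportation protocol on a finite set $\mathcal X_A=\mathcal X_C$: a finite set $\mathcal X_B$, a function $g:\mathcal X_A\times\mathcal X_B\times\mathcal X_C\to\{0,1\}$ and probability distributions $q_B$ on $\mathcal X_B$, $q_C$ on $\mathcal X_C$ such that for all probability distributions $p^A$ on $\mathcal X_A$ and all $c\in\mathcal X_C$, $\sum_{a,b}p^A(a)\,\delta_{g(a,b,c),1}\,q_B(b)\,q_C(c)=p_{\mathrm{tele}}\,p^A(c)$, where $p_{\mathrm{tele}}\in(0,1]$ (independent of $p^A$) is the success probability. Teleportation graphs. The family $\mathcal G_{\mathrm{tele}}(G)$ consists of all graphs $G_{\mathrm{t}}$ obtained thus: choose $S\subseteq V$ (''split vertices'') such that $(V,E')$ with $E'=E\setminus\bigcup_{v\in S}\mathrm{out}(v)$ is acyclic. The vertices of $G_{\mathrm t}$ are $V\cup\{R_v\}_{v\in S}\cup\{T_v\}_{v\in S}$ with new vertices $R_v$ (pre-selection) and $T_v$ (post-selection). The edges are $E'\cup\{(v,T_v),(R_v,T_v)\}_{v\in S}\cup\{(R_v,w): v\in S,\ w\in\mathrm{Ch}(v)\text{ in }G\}$. All such $G_{\mathrm t}$ are acyclic. Teleportation models. Given an fCM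 on $G$ and $G_{\mathrm t}\in\mathcal G_{\mathrm{tele}}(G)$, a classical teleportation model on $G_{\mathrm t}$ is an fCM in which: for each $v\in S$, $T_v$ takes values $t_v\in\{0,1\}$, $R_v$ takes values $r_v\in\mathcal X_v$ and equals its error variable, and the function $f^{T_v}$ with the error distributions $p^{T_v},p^{R_v}$ form a classical post-selected teleportation protocol ($g=f^{T_v}$ with arguments the value of $v$, the error of $T_v$, and the value of $R_v$; $q_B=p^{T_v}$, $q_C=p^{R_v}$), with success probability $p_{\mathrm{tele}}^{(v)}$; every $w\in V$ keeps the same sets, error variable and function as in the fCM on $G$, where $r_v$ replaces $x_v$ as an input for each $v\in S\cap \mathrm{Pa}(w)$ (parents in $G$). The post-selection success probability of a teleportation model is the marginal probability $P_{\mathrm{succ}}=P_{\mathrm{acyc}}(\{t_v=1\}_{v\in S})_{G_{\mathrm t}}$. *)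

(* Defs.v *)
(* Probabilities take values in an arbitrary realFieldType, of
   which the real numbers are an instance. *)
From HB Require Import structures.
From mathcomp Require Import all_boot all_order all_algebra.

Set Implicit Arguments.
Unset Strict Implicit.
Unset Printing Implicit Defensive.

Import Order.TTheory GRing.Theory Num.Theory.
Local Open Scope ring_scope.

(* A directed graph is a vertex type V : finType with its edges E : rel V, where
   E v w says that (v, w) is an edge from v to w; loops are allowed. *)

(* [cycle E c] holds of closed directed walks, [:: v] being closed iff E v v. *)
Definition acyclic (V : finType) (E : rel V) : Prop :=
  forall c : seq V, cycle E c -> c = [::].

Definition parent (V : finType) (E : rel V) (v : V) : finType := {w : V | E w v}.

Definition is_distribution (R : realFieldType) (T : finType) (p : T -> R) : Prop :=
  (forall t, 0 <= p t) /\ \sum_t p t = 1.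

Record fCM (R : realFieldType) (V : finType) (E : rel V) := FCM {
  val_set : V -> finType;
  val_set_nonempty : forall v, (0 < #|val_set v|)%N;
  err_set : V -> finType;
  err_dist : forall v, err_set v -> R;
  err_distP : forall v, is_distribution (@err_dist v);
  fun_dep : forall v,
    {dffun forall w : parent E v, val_set (val w)} -> err_set v -> val_set v
}.

Section Models.
Variables (R : realFieldType) (V : finType) (E : rel V) (M : fCM R E).

Definition valuation : finType := {dffun forall v, val_set M v}.

Definition err_valuation : finType := {dffun forall v, err_set M v}.

(* x_{Pa(v)} *)
Definition parent_values (x : valuation) (v : V) :
    {dffun forall w : parent E v, val_set M (val w)} :=
  [ffun w : parent E v => x (val w)].

(* Only meant for acyclic E; the formula itself makes sense for every E. *)
Definition P_acyc (x : valuation) : R :=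
  \sum_(u : err_valuation) \prod_(v : V)
    (err_dist (u v) * (x v == fun_dep (parent_values x v) (u v))%:R).

Definition num_solutions (u : err_valuation) : nat :=
  (\sum_(x : valuation) \prod_(v : V)
     (fun_dep (parent_values x v) (u v) == x v))%N.

Definition avg_num_solutions : R :=
  \sum_(u : err_valuation)
    (num_solutions u)%:R * \prod_(v : V) err_dist (u v).

End Models.

(* XA plays the role of both X_A and X_C; g = 1 is encoded as [true]. *)
Record tele_protocol (R : realFieldType) (XA : finType) := TeleProtocol {
  tp_B : finType;
  tp_g : XA -> tp_B -> XA -> bool;
  tp_qB : tp_B -> R;
  tp_qC : XA -> R;
  tp_prob : R;
  tp_qBP : is_distribution tp_qB;
  tp_qCP : is_distribution tp_qC;
  tp_prob_gt0 : 0 < tp_prob;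
  tp_prob_le1 : tp_prob <= 1;
  tp_teleports : forall pA : XA -> R, is_distribution pA -> forall c : XA,
    \sum_(a : XA) \sum_(b : tp_B) pA a * (tp_g a b c)%:R * tp_qB b * tp_qC c
    = tp_prob * pA c
}.

(* E' : the edges that do not leave a split vertex. *)
Definition cut_rel (V : finType) (E : rel V) (S : {set V}) : rel V :=
  [rel v w | E v w && (v \notin S)].

Definition split_set (V : finType) (E : rel V) (S : {set V}) : Prop :=
  acyclic (cut_rel E S).

Definition split_vertex (V : finType) (S : {set V}) : finType := {v : V | v \in S}.

Definition tele_vertex (V : finType) (S : {set V}) : finType :=
  (V + (split_vertex S + split_vertex S))%type.

Definition orig (V : finType) (S : {set V}) (v : V) : tele_vertex S := inl v.

(* R_v *)
Definition pre (V : finType) (S : {set V}) (v : split_vertex S) : tele_vertex S :=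
  inr (inl v).

(* T_v *)
Definition post (V : finType) (S : {set V}) (v : split_vertex S) : tele_vertex S :=
  inr (inr v).

Definition tele_rel (V : finType) (E : rel V) (S : {set V}) : rel (tele_vertex S) :=
  fun s t => match s, t with
  | inl v, inl w => cut_rel E S v w
  | inl v, inr (inr w) => v == val w
  | inr (inl v), inr (inr w) => v == w
  | inr (inl v), inl w => E (val v) w
  | _, _ => false
  end.

Lemma tele_rel_acyclic (V : finType) (E : rel V) (S : {set V}) :
  split_set E S -> acyclic (@tele_rel V E S).
Proof.
move=> acS c cyc.
have ori t : t \in c -> exists v, t = orig S v.
  move=> tc; have := next_cycle cyc tc; have := prev_cycle cyc tc.
  case: t {tc} => [v|[v|v]] /=; first by exists v.
    by case: (prev c _) => [?|[?|?]].
  by [].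
have [d dE] : exists d, c = map (orig S) d.
  elim: c ori {cyc} => [|t c IH] ori; first by exists [::].
  have [|d ->] := IH; first by move=> s sc; apply: ori; rewrite inE sc orbT.
  by have [v ->] := ori t (mem_head _ _); exists (v :: d).
by move: cyc; rewrite dE cycle_map => /acS ->.
Qed.

Section TeleModel.
Variables (R : realFieldType) (V : finType) (E : rel V) (M : fCM R E).
Variables (S : {set V}).
Variable Q : forall v : split_vertex S, tele_protocol R (val_set M (val v)).

Definition tele_val_set (t : tele_vertex S) : finType :=
  match t with
  | inl v => val_set M v
  | inr (inl v) => val_set M (val v)
  | inr (inr _) => bool
  end.

Definition tele_err_set (t : tele_vertex S) : finType :=
  match t with
  | inl v => err_set M v
  | inr (inl v) => val_set M (val v)
  | inr (inr v) => tp_B (Q v)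
  end.

Definition tele_err_dist (t : tele_vertex S) : tele_err_set t -> R :=
  match t with
  | inl v => @err_dist _ _ _ M v
  | inr (inl v) => @tp_qC _ _ (Q v)
  | inr (inr v) => @tp_qB _ _ (Q v)
  end.

Definition tele_input (t : tele_vertex S) : finType :=
  {dffun forall s : parent (@tele_rel V E S) t, tele_val_set (val s)}.

Lemma pre_orig_edge (w : V) (v : parent E w) (vS : val v \in S) :
  tele_rel E (pre (exist _ (val v) vS)) (orig S w).
Proof. exact: valP v. Qed.

Lemma orig_orig_edge (w : V) (v : parent E w) (vS : val v \notin S) :
  tele_rel E (orig S (val v)) (orig S w).
Proof. by apply/andP; split; first exact: valP v. Qed.

Lemma orig_post_edge (v : split_vertex S) :
  tele_rel E (orig S (val v)) (post v).
Proof. exact: eqxx. Qed.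

Lemma pre_post_edge (v : split_vertex S) : tele_rel E (pre v) (post v).
Proof. exact: eqxx. Qed.

(* The input of w in the original model: r_v replaces x_v when v is split. *)
Definition rewire (w : V) (y : tele_input (orig S w)) :
    {dffun forall v : parent E w, val_set M (val v)} :=
  [ffun v : parent E w =>
    match boolP (val v \in S) return val_set M (val v) with
    | AltTrue vS => y (exist _ (pre (exist _ (val v) vS)) (pre_orig_edge vS))
    | AltFalse vS => y (exist _ (orig S (val v)) (orig_orig_edge vS))
    end].

Definition tele_fun (t : tele_vertex S) :
    tele_input t -> tele_err_set t -> tele_val_set t :=
  match t return tele_input t -> tele_err_set t -> tele_val_set t with
  | inl w => fun y u => fun_dep (rewire y) u
  | inr (inl v) => fun _ u => u
  | inr (inr v) => fun y u =>
      tp_g (y (exist _ (orig S (val v)) (orig_post_edge v))) u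
           (y (exist _ (pre v) (pre_post_edge v)))
  end.

Lemma tele_val_set_nonempty (t : tele_vertex S) : (0 < #|tele_val_set t|)%N.
Proof.
by case: t => [v|[v|v]] /=; rewrite ?card_bool //; exact: val_set_nonempty.
Qed.

Lemma tele_err_distP (t : tele_vertex S) : is_distribution (@tele_err_dist t).
Proof.
by case: t => [v|[v|v]]; [exact: err_distP | exact: tp_qCP | exact: tp_qBP].
Qed.

(* Every classical teleportation model built from M with split vertices S has
   this form, for the family Q of protocols implemented at the split vertices. *)
Definition tele_model : fCM R (@tele_rel V E S) :=
  FCM tele_val_set_nonempty tele_err_distP tele_fun.

Definition P_succ : R :=
  \sum_(x : valuation tele_model |
        [forall v : split_vertex S, (x (post v) : bool) == true]) P_acyc x.

End TeleModel.

(* Main.v *)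
(* The error variables can be summed out vertex by vertex, and on the event
   T_v = 1 the joint weight of R_v and T_v is p_tele^(v) * [x_v = r_v], as one
   sees by teleporting a point mass.  Hence only the valuations with r_v = x_v
   contribute; these are the valuations x of the original model, and each has
   weight sum_u prod_v p^v(u_v) [f^v(x_Pa(v), u_v) = x_v] there. *)
Require Import Defs.
From HB Require Import structures.
From mathcomp Require Import all_boot all_order all_algebra.

Set Implicit Arguments.
Unset Strict Implicit.
Unset Printing Implicit Defensive.

Import Order.TTheory GRing.Theory Num.Theory.
Local Open Scope ring_scope.

(** Distributivity for dependent families: choice functions are encoded as functions into the tagged
    sum of the [T i], where the non-dependent law applies. *)
Lemma sum_prod_dffun (R : comPzSemiRingType) (I : finType) (T : I -> finType)
    (F : forall i, T i -> R) :
  \sum_(f : {dffun forall i, T i}) \prod_i F i (f i) =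
  \prod_i \sum_(t : T i) F i t.
Proof.
rewrite (reindex (@dffun_of_fprod _ T)) /=; last exact/onW_bij/dffun_of_fprod_bij.
under eq_bigr do under eq_bigr do rewrite ffunE -[F _ _](ffunE (F _)).
(* The default 0 of [untag] is never reached, since [u] ranges over elements with tag [i]. *)
rewrite big_fprod -(bigA_distr_big_dep (fun i => mem (tagged_with T i))
  (fun i u => untag 0 (finfun (F i)) u)).
apply: eq_bigr => i _; rewrite -(big_tag (fun i => finfun (F i))).
by apply: eq_bigr => t _; rewrite ffunE.
Qed.

Section Kernel.
Variables (R : realFieldType) (V : finType) (E : rel V) (M : fCM R E).

(** The conditional probability of [x v] given its parents' values. *)
Definition kernel (x : valuation M) (v : V) : R :=
  \sum_(e : err_set M v)
    err_dist e * (x v == fun_dep (parent_values x v) e)%:R.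

Lemma P_acyc_kernel (x : valuation M) : P_acyc x = \prod_v kernel x v.
Proof.
exact: (sum_prod_dffun (fun v (e : err_set M v) =>
  err_dist e * (x v == fun_dep (parent_values x v) e)%:R)).
Qed.

(** Exchanging the sums over errors and valuations shows that the average is the total mass of
    [P_acyc], which may differ from 1 when [E] has cycles. *)
Lemma avg_num_solutions_kernel :
  avg_num_solutions M = \sum_(x : valuation M) \prod_v kernel x v.
Proof.
under [RHS]eq_bigr do rewrite -P_acyc_kernel.
rewrite exchange_big; apply: eq_bigr => u _ /=.
rewrite /num_solutions natr_sum mulr_suml; apply: eq_bigr => x _.
rewrite natr_prod -big_split; apply: eq_bigr => v _ /=.
by rewrite mulrC eq_sym.
Qed.

End Kernel.

Lemma tele_dirac (R : realFieldType) (X : finType) (q : tele_protocol R X)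
    (a c : X) :
  tp_qC q c * (\sum_(b : tp_B q) tp_qB b * (tp_g a b c)%:R) = tp_prob q * (a == c)%:R.
Proof.
have dirac : is_distribution (fun x : X => (x == a)%:R : R).
  split=> [x|]; first exact: ler0n.
  by rewrite (bigD1 a) //= eqxx big1 ?addr0 // => x /negPf->.
rewrite eq_sym -(tp_teleports q dirac) (bigD1 a) //= eqxx [X in _ + X]big1 ?addr0.
  rewrite mulr_sumr; apply: eq_bigr => b _.
  by rewrite mul1r mulrC [_ * tp_qB _]mulrC.
by move=> x /negPf xa; rewrite big1 // => b _; rewrite xa !mul0r.
Qed.

Section Teleportation.
Variables (R : realFieldType) (V : finType) (E : rel V) (M : fCM R E).
Variables (S : {set V}).
Variable Q : forall v : split_vertex S, tele_protocol R (val_set M (val v)).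
Implicit Types (x : valuation (tele_model Q)) (y : valuation M).

Definition tele_extend y : valuation (tele_model Q) :=
  [ffun t : tele_vertex S =>
    match t return tele_val_set M t with
    | inl v => y v
    | inr (inl v) => y (val v)
    | inr (inr _) => true
    end].

Definition tele_restrict x : valuation M := [ffun v => x (orig S v)].

Lemma tele_extendK : cancel tele_extend tele_restrict.
Proof. by move=> y; apply/ffunP => v; rewrite !ffunE. Qed.

Definition post_selected x := [forall v, (x (post v) : bool) == true].

Definition faithful x :=
  [forall v : split_vertex S, (x (orig S (val v)) : val_set M (val v)) == x (pre v)].

Lemma tele_restrictK x :
  post_selected x && faithful x -> tele_extend (tele_restrict x) = x.
Proof.
case/andP=> /forallP ps /forallP fx; apply/ffunP => -[v|[v|v]]; rewrite !ffunE //.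
  exact/eqP/fx.
exact/esym/eqP/ps.
Qed.

Lemma post_selected_extend y : post_selected (tele_extend y).
Proof. by apply/forallP => v; rewrite ffunE. Qed.

Lemma faithful_extend y : faithful (tele_extend y).
Proof. by apply/forallP => v; rewrite !ffunE. Qed.

Lemma rewire_extend y (w : V) :
  rewire (parent_values (tele_extend y) (orig S w)) = parent_values y w.
Proof.
by apply/ffunP => v; rewrite !ffunE; case: {-}_ / boolP => vS; rewrite !ffunE.
Qed.

Lemma kernel_extend y (w : V) : kernel (tele_extend y) (orig S w) = kernel y w.
Proof. by apply: eq_bigr => e _; rewrite /= rewire_extend !ffunE. Qed.

(** [R_v] copies its error, so its kernel is [tp_qC] at [r_v]; the kernel of [T_v] at [true] is the
    probability that [tp_g] accepts. [tele_dirac] evaluates their product. *)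
Lemma kernel_pre_post x (v : split_vertex S) : post_selected x ->
  kernel x (pre v) * kernel x (post v) =
  tp_prob (Q v) * ((x (orig S (val v)) : val_set M (val v)) == x (pre v))%:R.
Proof.
move/forallP/(_ v)/eqP=> ps; rewrite -tele_dirac /kernel; congr (_ * _) => /=.
  rewrite (bigD1 (x (pre v))) //= eqxx mulr1 big1 ?addr0 // => e.
  by rewrite eq_sym => /negPf->; rewrite mulr0.
by apply: eq_bigr => b _; rewrite ps !ffunE eq_sym eqb_id.
Qed.

Lemma P_acyc_tele x : post_selected x ->
  P_acyc x = (\prod_v tp_prob (Q v)) *
    (if faithful x then \prod_w kernel x (orig S w) else 0).
Proof.
(* The product splits over original, [R] and [T] vertices; each [R_v] is then paired with its
   [T_v]. *)
move=> ps; rewrite P_acyc_kernel !big_sumType /= mulrC -big_split /=.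
under eq_bigr do rewrite (kernel_pre_post _ ps).
rewrite big_split -mulrA; congr (_ * _); case: ifP => [/forallP fx|].
  by rewrite big1 ?mul1r // => v _; rewrite fx.
(* A single split vertex with [r_v] different from [x_v] makes the whole product vanish. *)
by case/forallPn => v /negPf fx; rewrite (bigD1 v) //= fx !mul0r.
Qed.

End Teleportation.

Theorem proposition3 (R : realFieldType) (V : finType) (E : rel V)
    (M : fCM R E) (S : {set V}) (hS : split_set E S)
    (Q : forall v : split_vertex S, tele_protocol R (val_set M (val v))) :
  P_succ Q = (\prod_(v : split_vertex S) tp_prob (Q v)) * avg_num_solutions M.
Proof.
rewrite /P_succ (eq_bigr _ (@P_acyc_tele _ _ _ _ _ Q)).
rewrite -mulr_sumr avg_num_solutions_kernel; congr (_ * _).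
(* The surviving valuations are exactly the images under [tele_extend], so the sum now runs over
   valuations of [M]. *)
rewrite -big_mkcondr (reindex_onto _ _ (@tele_restrictK _ _ _ _ _ Q)) /=.
apply: eq_big => [y|y _].
  by rewrite [post_selected _]post_selected_extend faithful_extend tele_extendK eqxx.
by apply: eq_bigr => w _; rewrite kernel_extend.
Qed.
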